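(* The topological space $\mathcal{E}$ is contractible.
   Context: $\mathbb{N}=\{1,2,\dots\}$. An MPS tensor of physical dimension $d$ and bond dimension $\chi$ is $K=(K^1,\dots,K^d)\in M_\chi(\mathbb{C})^d$; it is injective if $K^1,\dots,K^d$ span $M_\chi(\mathbb{C})$ and right-normalized if $\sum_i K^iK^{i*}=\mathbb{1}$. $\mathcal{I}(d,\chi)\subset M_\chi(\mathbb{C})^d$ is the subspace of right-normalized injective MPS tensors. $\mathcal{M}$ is the set of arrays $A=(A^i_{\alpha\beta})_{i,\alpha,\beta\in\mathbb{N}}$ of complex numbers with only finitely many nonzero entries, viewed as sequences of infinite matrices $A^i$. $\mathcal{M}(d,D)\subset\mathcal{M}$ consists of arrays with $A^i_{\alpha\beta}=0$ whenever $i>d$ or $\alpha>D$ or $\beta>D$; it is a finite-dimensional vector space with its usual topology. Finite matrices are regarded as infinite ones by padding with zeros. For $\chi\le D$, $\mathcal{E}(d,D,\chi)$ is the set of $A\in\mathcal{M}(d,D)$ of the form $A^i=X\begin{pmatrix} K^i & 0 \\ M^i & 0 \end{pmatrix}X^{-1}$ with $X\in\mathrm{U}(D)$, $K\in\mathcal{I}(d,\chi)$ and arbitrary complex $(D-\chi)\times\chi$ matrices $M^i$. Set $\mathcal{E}(d,D)=\bigcup_{\chi\le D}\mathcal{E}(d,D,\chi)$ with the subspace topology from $\mathcal{M}(d,D)$, and $\mathcal{E}=\bigcup_{d,D\in\mathbb{N}}\mathcal{E}(d,D)$ with the final (colimit) topology induced by the inclusions $\mathcal{E}(d,D)\hookrightarrow\mathcal{E}$.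 *)

(* Defs.v *)
From HB Require Import structures.
From mathcomp Require Import all_boot all_order all_algebra.
From mathcomp Require Import all_classical all_reals all_analysis.
From mathcomp Require Import complex.

Set Implicit Arguments.
Unset Strict Implicit.
Unset Printing Implicit Defensive.

Import Order.TTheory GRing.Theory Num.Theory.
Import numFieldNormedType.Exports.

Local Open Scope classical_set_scope.
Local Open Scope ring_scope.
Local Open Scope sesquilinear_scope.

Definition final_topology {I : Type} {X : I -> Type} {S : Type}
  (f : forall i, X i -> S) : Type := S.

Section FinalTopology.
Context {I : Type} {X : I -> topologicalType} {S : choiceType}.
Variable f : forall i, X i -> S.
Local Notation F := (final_topology (X := X) f).

Definition final_open (U : set F) : Prop := forall i, open (@f i @^-1` U).

Local Lemma final_openT : final_open [set: F].
Proof. by move=> i; rewrite preimage_setT; exact: openT. Qed.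

Local Lemma final_openI : setI_closed final_open.
Proof. by move=> U V oU oV i; rewrite preimage_setI; exact: openI. Qed.

Local Lemma final_open_bigU (J : Type) (g : J -> set F) :
  (forall j, final_open (g j)) -> final_open (\bigcup_j g j).
Proof.
by move=> og i; rewrite preimage_bigcup; apply: bigcup_open => j _; exact: og.
Qed.

HB.instance Definition _ := Choice.on F.
HB.instance Definition _ :=
  isOpenTopological.Build F final_openT final_openI final_open_bigU.

End FinalTopology.

Definition homotopic (R : realType) (X Y : topologicalType) (f g : X -> Y) :=
  exists H : X * set_type (`[0, 1] : set R) -> Y,
    [/\ continuous H,
        forall x t, set_val t = 0 -> H (x, t) = f x &
        forall x t, set_val t = 1 -> H (x, t) = g x].

Definition contractible (R : realType) (X : topologicalType) :=
  exists x0 : X, homotopic R idfun (cst x0).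

(* [C] stands for the complex numbers [R[i]], with the topology of the norm. *)
Section MPS.
Variable C : numClosedFieldType.

Definition mps_tensor (d chi : nat) := 'I_d -> 'M[C]_chi.

Definition injective_mps d chi (K : mps_tensor d chi) : Prop :=
  <<codom K>>%VS = fullv.

Definition right_normalized d chi (K : mps_tensor d chi) : Prop :=
  \sum_(i < d) K i *m (K i)^t* = 1%:M.

Definition Imps (d chi : nat) : set (mps_tensor d chi) :=
  [set K | right_normalized K /\ injective_mps K].

(* The indices of an array start at 0 instead of 1. *)
Definition Marr : Type :=
  set_type [set A : nat -> nat -> nat -> C |
    finite_set [set x : nat * nat * nat | A x.1.1 x.1.2 x.2 != 0]].

HB.instance Definition _ := Choice.on Marr.

Definition entry (A : Marr) : nat -> nat -> nat -> C := set_val A.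

Definition Mbd (d D : nat) : set Marr :=
  [set A | forall i a b, [|| d <= i, D <= a | D <= b]%N -> entry A i a b = 0].

Definition corner (d D : nat) (A : Marr) : 'I_d -> 'M[C]_D :=
  fun i => \matrix_(a, b) entry A i a b.

Arguments corner : clear implicits.

(* [corner d D] is a linear isomorphism from [Mbd d D] onto the
   finite-dimensional space of [d]-tuples of matrices, whose (product) topology
   it transports to [Mbd d D]. *)
Definition Mbd_space (d D : nat) : Type :=
  initial_topology (corner d D \o set_val : Mbd d D -> {ptws 'I_d -> 'M[C]_D}).

HB.instance Definition _ d D := Topological.on (Mbd_space d D).

Definition Ebond (d D chi : nat) : set Marr :=
  [set A | Mbd d D A /\
    exists (hchi : (chi <= D)%N) (X : 'M[C]_D) (K : mps_tensor d chi)
           (N : 'I_d -> 'M[C]_(D - chi, chi)),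
      [/\ X \is unitarymx, Imps K &
          forall i, corner d D A i =
            X *m castmx (subnKC hchi, subnKC hchi)
                   (block_mx (K i) 0 (N i) 0) *m invmx X]].

(* Bond dimensions are positive. *)
Definition Ebd (d D : nat) : set Marr :=
  \bigcup_(chi in [set chi | 0 < chi <= D]%N) Ebond d D chi.

Lemma Ebd_sub_Mbd d D : Ebd d D `<=` Mbd d D.
Proof. by move=> A [chi _ []]. Qed.

Definition Ebd_to_Mbd (d D : nat) (A : Ebd d D) : Mbd_space d D :=
  exist _ (set_val A) (mem_set (@Ebd_sub_Mbd d D _ (set_valP A))).

Definition Ebd_space (d D : nat) : Type :=
  initial_topology (@Ebd_to_Mbd d D).

HB.instance Definition _ d D := Topological.on (Ebd_space d D).

(* The pair [p] stands for [d = p.1 + 1] and [D = p.2 + 1], which range over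
   the positive integers. *)
Definition Emps : set Marr := \bigcup_(p : nat * nat) Ebd p.1.+1 p.2.+1.

Definition Ebd_to_Emps (p : nat * nat) (A : Ebd_space p.1.+1 p.2.+1) : Emps :=
  exist _ (set_val A)
    (mem_set (bigcup_sup (F := fun q => Ebd q.1.+1 q.2.+1) (i := p) I (set_valP A))).

Definition Espace : Type := final_topology Ebd_to_Emps.

HB.instance Definition _ := Topological.on Espace.

End MPS.

(* Main.v *)
Require Import Defs.
From mathcomp Require Import all_boot all_order all_algebra all_classical all_reals all_analysis.
From mathcomp Require Import complex.
From mathcomp Require Import ring lra zify.

(* The contraction of [A] first moves its bond and physical indices along a
   path of isometries from the identity to [k |-> 2k+1]; this frees a basis
   vector [e_0] and infinitely many physical indices. Let [N] be the sum of the
   [|A i k l|^2]. At pairwise distinct physical indices, put the matrices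
     [a A^i],  [b e_0 (row k of A^i)],  [g (column l of A^i) e_0^*],  [e e_0 e_0^*].
   If [a = 1] and [g = e = 0], this tensor has the bond space of [A]. If
   [|a|^2 + |g|^2 = 1], [|b|^2 N + |e|^2 = 1] and no coefficient vanishes, it is
   right-normalized and injective on the sum of that space and [e_0]. If
   [a = b = 0] and [e = 1], its bond space is spanned by [e_0]. So the path
     [(1, 0, 0, 0) -> (1, N^(-1/2), 0, 0) -> (0, 0, 1, 1) -> (0, 0, 0, 1)]
   of coefficients [(a, b, g, e)] stays in the space and ends at a tensor that
   does not depend on [A]. The projection onto the bond space of [A], which is
   not continuous in [A], never occurs in these formulas. *)

Set Implicit Arguments.
Unset Strict Implicit.
Unset Printing Implicit Defensive.

Import Order.TTheory GRing.Theory Num.Theory.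
Import numFieldNormedType.Exports.

Local Open Scope classical_set_scope.
Local Open Scope ring_scope.
Local Open Scope sesquilinear_scope.

(** * A path of isometries *)

Section Isometry.
Variables (F : comPzRingType) (c s : F).

(* Let [R_k] be the rotation sending [e_k] to [c e_k + s e_(2k+1)]. Then
   [isocol k] is [R_0 R_1 R_2 ... e_k], where the [R_j] with [j > k] fix [e_k],
   and [wcol k] is [R_0 ... R_(k-1) e_k]. The argument [n >= k] of [wcol_rec]
   is fuel. *)
Fixpoint wcol_rec (n k a : nat) : F :=
  if n is n'.+1 then
    if odd k then c * (a == k)%:R - s * wcol_rec n' k./2 a else (a == k)%:R
  else (a == k)%:R.

Definition wcol k := wcol_rec k k.

Definition isocol k a : F := c * wcol k a + s * (a == k.*2.+1)%:R.

Lemma wcol_recE n k a : (k <= n)%N -> wcol_rec n k a = wcol k a.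
Proof.
(* Frees the fuel on the right as well, so that the induction compares two arbitrary amounts of fuel
   [n, m >= k]. *)
rewrite /wcol => kn; move: (leqnn k) kn; move: {2 5}k => m.
elim: n m k => [|n IH] [|m] k //=.
- by move=> _; rewrite leqn0 => /eqP ->.
- by rewrite leqn0 => /eqP -> _.
move=> km kn; case: ifP => // _; congr (_ - _ * _); apply: IH; lia.
Qed.

Lemma wcol_even k a : ~~ odd k -> wcol k a = (a == k)%:R.
Proof. by rewrite /wcol; case: k => //= k /negPf ->. Qed.

(** Among the [R_i] with [i <= 2j] only [R_j] moves [e_(2j+1)], namely to [c e_(2j+1) - s e_j]; then
    [R_0 ... R_(j-1)] turns [e_j] into [wcol j]. *)
Lemma wcol_odd j a : wcol j.*2.+1 a = c * (a == j.*2.+1)%:R - s * wcol j a.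
Proof.
rewrite {1}/wcol /= odd_double /= uphalf_double wcol_recE //; lia.
Qed.

Lemma wcol_gt k a : (k < a)%N -> wcol k a = 0.
Proof.
elim/ltn_ind: k a => k IH a ka; have [ko|ke] := boolP (odd k); last first.
  by rewrite wcol_even // gtn_eqF.
have kE : k = k./2.*2.+1 by rewrite -[LHS]odd_double_half ko.
rewrite kE wcol_odd -kE gtn_eqF // IH ?mulr0 ?subr0 //; lia.
Qed.

(** The bound on the support does not involve [c] and [s], so a deformed array stays in one [Mbd]
    along the whole path. *)
Lemma isocol_gt k a : (k.*2.+1 < a)%N -> isocol k a = 0.
Proof. by move=> ka; rewrite /isocol wcol_gt ?gtn_eqF ?mulr0 ?addr0 //; lia. Qed.

Section Dot.
Variable N : nat.
Definition dot (x y : nat -> F) := \sum_(a < N) x a * y a.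

Lemma dotC x y : dot x y = dot y x.
Proof. by apply: eq_bigr => a _; rewrite mulrC. Qed.

Lemma dotDr x y z p q :
  dot x (fun a => p * y a + q * z a) = p * dot x y + q * dot x z.
Proof. by rewrite /dot !mulr_sumr -big_split; apply: eq_bigr => a _ /=; ring. Qed.

Lemma dot_delta x m : (m < N)%N -> dot x (fun a => (a == m)%:R) = x m.
Proof.
move=> mN; rewrite /dot (bigD1 (Ordinal mN)) //= eqxx mulr1 big1 ?addr0 // => a.
by rewrite -val_eqE /= => /negPf ->; rewrite mulr0.
Qed.

Lemma dot_wcol_odd x j : (j.*2.+1 < N)%N ->
  dot x (wcol j.*2.+1) = c * x j.*2.+1 - s * dot x (wcol j).
Proof.
move=> jN; rewrite -(dot_delta x jN) -mulNr -dotDr.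
by apply: eq_bigr => a _; rewrite wcol_odd mulNr.
Qed.

Lemma dot_wcol_even x k : (k < N)%N -> ~~ odd k -> dot x (wcol k) = x k.
Proof.
move=> kN ke; rewrite -(dot_delta x kN); apply: eq_bigr => a _.
by rewrite wcol_even.
Qed.

Lemma dot_isocol x k : (k.*2.+1 < N)%N ->
  dot x (isocol k) = c * dot x (wcol k) + s * x k.*2.+1.
Proof. by move=> kN; rewrite -(dot_delta x kN) -dotDr. Qed.

Hypothesis cs1 : c ^+ 2 + s ^+ 2 = 1.

(** In [wcol_odd], [wcol j] vanishes beyond index [j] and is thus orthogonal to [e_(2j+1)]; by
    induction the squared norm is [c^2 + s^2]. *)
Lemma dot_wcol1 k : (k < N)%N -> dot (wcol k) (wcol k) = 1.
Proof.
elim/ltn_ind: k => k IH kN; have [ko|ke] := boolP (odd k); last first.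
  by rewrite dot_wcol_even // wcol_even // eqxx.
have kE : k = k./2.*2.+1 by rewrite -[LHS]odd_double_half ko.
have kh : (k./2 < k)%N by lia.
have dotE x : dot x (wcol k) = c * x k - s * dot x (wcol k./2).
  by rewrite {1}kE dot_wcol_odd -?kE.
rewrite dotE [dot _ (wcol k./2)]dotC dotE IH //; last lia.
have -> : wcol k k = c by rewrite {1}kE wcol_odd -kE eqxx wcol_gt // mulr1 mulr0 subr0.
rewrite wcol_gt // -[RHS]cs1; ring.
Qed.

(* Index [j] is not in the chain [i, 2i+1, 2(2i+1)+1, ...] nor [i] in that of
   [j], so the two columns have disjoint supports. *)
Lemma dot_wcol0 i j : (j < N)%N -> (i < j < i.*2.+1)%N -> dot (wcol i) (wcol j) = 0.
Proof.
elim/ltn_ind: j i => j IH i jN /andP[ij ji].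
have [jo|je] := boolP (odd j); last by rewrite dot_wcol_even // wcol_gt.
have jE : j = j./2.*2.+1 by rewrite -[LHS]odd_double_half jo.
rewrite jE dot_wcol_odd -?jE // wcol_gt // dotC IH ?mulr0 ?subrr //; lia.
Qed.

(** Since [R_i] fixes [e_j] for [j < i < m], the two vectors are the images of [e_j] and [e_m] under
    the same orthogonal map [R_0 ... R_(m-1)]. The induction on [m] checks this in coordinates. *)
Lemma dot_isocol_wcol j m : (m < N)%N -> (j.*2.+1 < N)%N -> (j < m)%N ->
  dot (isocol j) (wcol m) = 0.
Proof.
move=> mN jN; elim/ltn_ind: m mN => m IH mN jm.
case: (boolP (odd m)) => [mo|me]; last first.
  rewrite dot_wcol_even // /isocol wcol_gt //.
  have -> : (m == j.*2.+1) = false by apply: contraNF me => /eqP ->; rewrite /= odd_double.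
  by rewrite !mulr0 addr0.
have [i mE] : exists i, m = i.*2.+1.
  by exists m./2; rewrite -[LHS]odd_double_half mo.
subst m; rewrite dot_wcol_odd // {1}/isocol wcol_gt // mulr0 add0r eqSS.
(* With [m = 2i+1]: for [i < j] the supports of [wcol i] and [wcol j] are disjoint, [i > j] is the
   induction hypothesis, and for [i = j] the contributions [c s] and [s c] cancel. *)
rewrite (inj_eq double_inj); have [ij|ij|ij] := ltngtP i j.
- by rewrite dotC dot_isocol // wcol_gt ?dot_wcol0 ?mulr0 ?addr0 ?mulr0 ?subrr //; lia.
- by rewrite IH ?mulr0 ?subrr //; lia.
- rewrite ij dotC dot_isocol // dot_wcol1; last lia.
  by rewrite wcol_gt /=; [ring|lia].
Qed.

Lemma dot_isocol_isocol j k : (j.*2.+1 < N)%N -> (k.*2.+1 < N)%N ->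
  dot (isocol j) (isocol k) = (j == k)%:R.
Proof.
wlog jk : j k / (j <= k)%N => [hw jN kN|jN kN].
  by have [/hw|/ltnW/hw] := leqP j k; last rewrite dotC eq_sym; exact.
rewrite dot_isocol //; have [ltjk|gtjk|<-] := ltngtP j k; last 1 first.
- rewrite dotC dot_isocol // dot_wcol1; last lia.
  rewrite /isocol eqxx wcol_gt /=; last lia.
  by rewrite -[RHS]cs1; ring.
- rewrite dot_isocol_wcol //; last lia.
  by rewrite isocol_gt ?mulr0 ?addr0 //; lia.
- by move: jk; rewrite leqNgt gtjk.
Qed.

End Dot.
End Isometry.

Lemma wcol_id (F : comPzRingType) k a : wcol (1 : F) 0 k a = (a == k)%:R.
Proof.
have [ko|ke] := boolP (odd k); last by rewrite wcol_even.
have -> : k = k./2.*2.+1 by rewrite -[LHS]odd_double_half ko.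
by rewrite wcol_odd mul1r mul0r subr0.
Qed.

Lemma isocol_id (F : comPzRingType) k a : isocol (1 : F) 0 k a = (a == k)%:R.
Proof. by rewrite /isocol wcol_id mul1r mul0r addr0. Qed.

Lemma isocol_shift (F : comPzRingType) k a : isocol (0 : F) 1 k a = (a == k.*2.+1)%:R.
Proof. by rewrite /isocol mul0r add0r mul1r. Qed.

(** * Characterisation of the spaces of tensors *)

Section Adjoint.
Variable C : numClosedFieldType.

Lemma trmxC_mul m n p (A : 'M[C]_(m, n)) (B : 'M[C]_(n, p)) :
  (A *m B)^t* = B^t* *m A^t*.
Proof. by rewrite trmx_mul map_mxM. Qed.

(** Gram-Schmidt applied to a basis of the orthogonal complement of the row space of [U]. *)
Lemma unitary_complement m r (U : 'M[C]_(m, m + r)) : U \is unitarymx ->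
  exists2 Z : 'M[C]_(r, m + r), U *m Z^t* = 0 & Z \is unitarymx.
Proof.
move=> uU.
(* The complement comes with its rank as number of rows, which equals [r] only propositionally; [k]
   absorbs the mismatch. *)
suff [k [-> [Z Z0 uZ]]] : exists k, k = r /\
    exists2 Z : 'M[C]_(k, m + r), U *m Z^t* = 0 & Z \is unitarymx by exists Z.
exists (\rank (orthomx Num.conj (hermitian1mx (m + r)) U)); split.
  by rewrite rank_ortho mxrank_unitary // addKn.
exists (schmidt (row_base (orthomx Num.conj (hermitian1mx (m + r)) U))).
  apply/orthomx1P; rewrite orthomx_sym.
  by rewrite eqmx_schmidt_free ?row_base_free // eq_row_base.
by rewrite schmidt_unitarymx // rank_leq_col.
Qed.

End Adjoint.

Section Families.
Variable C : numClosedFieldType.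

(** Any finite index type is allowed, so that a family can be studied before its members are placed
    at physical indices. *)
Definition spanning (I : finType) n (K : I -> 'M[C]_n) :=
  forall M, exists a : I -> C, M = \sum_i a i *: K i.

Definition normalized (I : finType) n (K : I -> 'M[C]_n) :=
  \sum_i K i *m (K i)^t* = 1%:M.

Lemma injective_mpsP d chi (K : mps_tensor C d chi) :
  injective_mps K <-> spanning K.
Proof.
split=> [inj M|sp].
  have : M \in <<codom_tuple K>>%VS by rewrite inj memvf.
  move=> /coord_span ->; exists (fun i => coord (codom_tuple K) (enum_rank i) M).
  rewrite (reindex enum_rank) /=; last first.
    by exists enum_val => i _; rewrite ?enum_rankK ?enum_valK.
  by apply: eq_bigr => i _; rewrite nth_codom enum_rankK.
apply/eqP; rewrite eqEsubv subvf /=; apply/subvP => M _.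
have [a ->] := sp M; apply: memv_suml => i _; apply: memvZ; apply: memv_span.
exact: codom_f.
Qed.

(** [S] is an isometry between spaces of physical indices. Its orthonormality relation collapses the
    double sum in the normalization, and recovers [K i] as the combination of the [G j] whose
    coefficients are the conjugates of the [S j i]. *)
Lemma isometric_family (I J : finType) n (S : J -> I -> C)
    (K : I -> 'M[C]_n) (G : J -> 'M[C]_n) :
  (forall i i', \sum_j S j i * (S j i')^* = (i == i')%:R) ->
  (forall j, G j = \sum_i S j i *: K i) ->
  normalized K /\ spanning K -> normalized G /\ spanning G.
Proof.
move=> Siso GE [nK sK]; split.
  rewrite /normalized -[RHS]nK.
  transitivity (\sum_i \sum_i' \sum_j (S j i * (S j i')^*) *: (K i *m (K i')^t*)).
    rewrite (eq_bigr (fun j => \sum_i \sum_i' (S j i * (S j i')^*) *: (K i *m (K i')^t*))).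
      by rewrite exchange_big; apply: eq_bigr => i _; rewrite exchange_big.
    move=> j _; rewrite GE linear_sum raddf_sum mulmx_suml /=.
    apply: eq_bigr => i _; rewrite mulmx_sumr; apply: eq_bigr => i' _.
    by rewrite linearZ /= map_mxZ -scalemxAl -scalemxAr scalerA.
  apply: eq_bigr => i _; rewrite (bigD1 i) //= -scaler_suml Siso eqxx scale1r.
  rewrite big1 ?addr0 // => i' /negPf ii'.
  by rewrite -scaler_suml Siso eq_sym ii' scale0r.
move=> M; have [a ->] := sK M.
exists (fun j => \sum_i a i * (S j i)^*).
under [RHS]eq_bigr => j _.
  rewrite GE scaler_suml.
  under eq_bigr => i _ do rewrite scaler_sumr.
  over.
rewrite exchange_big; apply: eq_bigr => i _ /=; rewrite exchange_big (bigD1 i) //=.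
rewrite [X in _ = _ + X]big1 ?addr0 => [|i' /negPf ii'].
  rewrite (eq_bigr (fun j => (a i * (S j i * (S j i)^*)) *: K i)); last first.
    by move=> j _; rewrite scalerA; congr (_ *: _); ring.
  by rewrite -scaler_suml -mulr_sumr Siso eqxx mulr1.
rewrite (eq_bigr (fun j => (a i * (S j i' * (S j i)^*)) *: K i')); last first.
  by move=> j _; rewrite scalerA; congr (_ *: _); ring.
by rewrite -scaler_suml -mulr_sumr Siso ii' mulr0 scale0r.
Qed.

End Families.

Section BondDimension.
Variable C : numClosedFieldType.

(** Together with [Ebond_elim], this describes [Ebond] by an isometry [Y] onto the bond space alone,
    without casts: each matrix kills the complement of the range of [Y], and the compressions to
    this range form an injective right-normalized tensor. Completing [Y] to a unitary gives the
    block form. *)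
Lemma Ebond_intro d D chi (A : Marr C) (Y : 'M[C]_(D, chi)) :
  Mbd d D A -> Y^t* *m Y = 1%:M ->
  (forall i : 'I_d, corner D A i *m (Y *m Y^t*) = corner D A i) ->
  let K i := Y^t* *m corner D A (i : 'I_d) *m Y in
  normalized K -> spanning K -> Ebond d D chi A.
Proof.
move=> AM YY AY K nK sK; split => //.
have uY : Y^t* \is unitarymx by apply/unitarymxP; rewrite trmxCK.
have hchi : (chi <= D)%N by rewrite -(mxrank_unitary uY) rank_leq_col.
(* Generalising [D - chi] to [r] allows elimination of [chi + r = D], after which the cast is the
   identity. *)
exists hchi; move: (subnKC hchi); move: (D - chi)%N => r e.
have iK : Imps K by split=> //; apply/injective_mpsP.
move: {hchi} Y YY AY @K nK sK iK uY AM; case: D / e => Y YY AY K nK sK iK uY AM.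
have [Z YZ uZ] := unitary_complement uY.
have ZZ := unitarymxP uZ.
have uX : row_mx Y (Z^t*) \is unitarymx.
  rewrite -trmxC_unitary; apply/unitarymxP.
  rewrite trmxCK tr_row_mx map_col_mx trmxCK mul_col_row YY YZ ZZ.
  by rewrite -[Z *m Y]trmxCK trmxC_mul YZ trmx0 map_mx0 -scalar_mx_block.
exists (row_mx Y (Z^t*)), K, (fun i => Z *m corner (chi + r) A i *m Y); split => // i.
rewrite castmx_id; apply: (canRL (mulmxK _)); first exact: unitarymx_unit.
have : Y *m Y^t* + Z^t* *m Z = 1%:M.
  have := uX; rewrite -trmxC_unitary => /unitarymxP/mulmx1C.
  by rewrite trmxCK tr_row_mx map_col_mx trmxCK mul_row_col.
move=> XX; rewrite mul_mx_row -[X in row_mx _ X]add0r.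
have AZ : corner (chi + r) A i *m Z^t* = 0.
  by rewrite -(AY i) -!mulmxA [Y^t* *m _]YZ !mulmx0.
rewrite AZ /block_mx mul_row_col !mul_mx_row !mulmx0 add_row_mx addr0.
congr (row_mx _ _).
by rewrite /K !mulmxA -!mulmxDl XX mul1mx.
Qed.

(** [Y] consists of the first [chi] columns of the unitary [X]. *)
Lemma Ebond_elim d D chi (A : Marr C) : Ebond d D chi A ->
  exists Y : 'M[C]_(D, chi),
    let K i := Y^t* *m corner D A (i : 'I_d) *m Y in
    [/\ Y^t* *m Y = 1%:M,
      (forall i : 'I_d, corner D A i *m (Y *m Y^t*) = corner D A i),
      normalized K & spanning K].
Proof.
case=> _ [hchi]; move: (subnKC hchi); move: (D - chi)%N => r e.
case: D / e {hchi} => -[X [K [N [uX [nK /injective_mpsP sK] AE]]]].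
pose P : 'M[C]_(chi + r, chi) := col_mx 1%:M 0.
have PC : P^t* = row_mx 1%:M 0.
  by rewrite tr_col_mx map_row_mx trmx1 map_mx1 trmx0 map_mx0.
have PP : P^t* *m P = 1%:M by rewrite PC mul_row_col mul1mx mul0mx addr0.
have XX : X^t* *m X = 1%:M by apply: mulmx1C; exact/unitarymxP.
have BP i : block_mx (K i) 0 (N i) 0 *m (P *m P^t*) = block_mx (K i) 0 (N i) 0.
  by rewrite PC mul_col_row !mulmx1 !mulmx0 mulmx_block !mulmx1 !mulmx0 !addr0.
exists (X *m P) => /=.
have KE i : (X *m P)^t* *m corner (chi + r) A i *m (X *m P) = K i.
  rewrite AE castmx_id invmx_unitary // trmxC_mul !mulmxA.
  rewrite -[_ *m X^t* *m X]mulmxA XX mulmx1 -[_ *m X^t* *m X]mulmxA XX mulmx1.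
  rewrite PC /block_mx mul_row_col mul1mx mul0mx addr0 mul_row_col.
  by rewrite mulmx1 mulmx0 addr0.
split.
- by rewrite trmxC_mul mulmxA -[_ *m X^t* *m X]mulmxA XX mulmx1.
- move=> i; rewrite AE castmx_id invmx_unitary // trmxC_mul !mulmxA.
  rewrite -[_ *m X^t* *m X]mulmxA XX mulmx1.
  by rewrite -[_ *m P *m P^t*]mulmxA -[X *m _ *m (P *m _)]mulmxA BP.
- by rewrite /normalized -[RHS]nK; apply: eq_bigr => i _; rewrite KE.
- by move=> M; have [a ->] := sK M; exists a; apply: eq_bigr => i _; rewrite KE.
Qed.

End BondDimension.

(** * Interpolation between bond dimensions *)

Section Interpolation.
Variables (C : numClosedFieldType) (d D m : nat).
Variables (A : 'I_d -> 'M[C]_D) (T : 'M[C]_(m, D)) (v : 'cV[C]_m).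
Variables (a b g e : C).

Definition family_index : finType :=
  ('I_d + 'I_d * 'I_D + 'I_d * 'I_D + unit)%type.

Definition mps_family (w : family_index) : 'M[C]_m :=
  match w with
  | inl (inl (inl i)) => a *: (T *m A i *m T^t*)
  | inl (inl (inr p)) => b *: (v *m row p.2 (A p.1) *m T^t*)
  | inl (inr p) => g *: (T *m col p.2 (A p.1) *m v^t*)
  | inr _ => e *: (v *m v^t*)
  end.

Lemma big_family (V : nmodType) (f : family_index -> V) :
  \sum_w f w = \sum_i f (inl (inl (inl i))) +
    \sum_i \sum_k f (inl (inl (inr (i, k)))) +
    \sum_i \sum_l f (inl (inr (i, l))) + f (inr tt).
Proof.
rewrite !big_sumType /= (big_pred1 tt) => [|[]//].
by rewrite !pair_big /=; congr (_ + _ + _ + _); apply: eq_bigr => -[].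
Qed.

Hypotheses (TT : T^t* *m T = 1%:M) (vv : v^t* *m v = 1%:M) (Tv : T^t* *m v = 0).

Let vT : v^t* *m T = 0.
Proof. by rewrite -[LHS]trmxCK trmxC_mul trmxCK Tv trmx0 map_mx0. Qed.

(** The matrices with coefficient [g] send [v] into the range of [T], which is orthogonal to [v].
    They only fill the arbitrary block below the [1 x 1] tensor, so [g] is free here and can later
    be moved to [0]. *)
Lemma family_vector : a = 0 -> b = 0 -> e = 1 ->
  [/\ forall w, mps_family w *m (v *m v^t*) = mps_family w,
      normalized (fun w => v^t* *m mps_family w *m v) &
      spanning (fun w => v^t* *m mps_family w *m v)].
Proof.
move=> a0 b0 e1.
have vvv : v^t* *m (v *m v^t*) = v^t* by rewrite mulmxA vv mul1mx.
pose K (w : family_index) : 'M[C]_1 := if w is inr _ then 1%:M else 0.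
have KE w : v^t* *m mps_family w *m v = K w.
  case: w => [[[i|p]|p]|[]] /=.
  - by rewrite a0 scale0r mulmx0 mul0mx.
  - by rewrite b0 scale0r mulmx0 mul0mx.
  - by rewrite -scalemxAr -scalemxAl !mulmxA vT !mul0mx scaler0.
  - by rewrite e1 scale1r vvv vv.
split.
- case=> [[[i|p]|p]|[]] /=.
  - by rewrite a0 !scale0r mul0mx.
  - by rewrite b0 !scale0r mul0mx.
  - by rewrite -scalemxAl -mulmxA vvv.
  - by rewrite -scalemxAl -mulmxA vvv.
- rewrite /normalized (eq_bigr (fun w => K w *m (K w)^t*)) => [|w _]; last by rewrite KE.
  rewrite big_family /K /= trmx1 map_mx1 mul1mx !big1 ?add0r // => *; rewrite mul0mx //.
- move=> M; exists (fun=> M 0 0).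
  rewrite (eq_bigr (fun w => M 0 0 *: K w)) => [|w _]; last by rewrite KE.
  rewrite -scaler_sumr big_family /K /= !big1 ?add0r //.
  - by rewrite scalemx1 -mx11_scalar.
Qed.

Variables (chi : nat) (Y : 'M[C]_(D, chi)).
Let K i := Y^t* *m A i *m Y.
Hypotheses (YY : Y^t* *m Y = 1%:M) (AY : forall i, A i *m (Y *m Y^t*) = A i).
Hypotheses (nK : normalized K) (sK : spanning K).
Hypotheses (ag : a * a^* + g * g^* = 1).
Hypotheses (be : b * b^* * (\sum_i \sum_k \sum_l A i k l * (A i k l)^*) + e * e^* = 1).

Let X : 'M[C]_(m, chi + 1) := row_mx (T *m Y) v.

Let XC : X^t* = col_mx (Y^t* *m T^t*) (v^t*).
Proof. by rewrite tr_row_mx map_col_mx trmxC_mul. Qed.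

Lemma isometry_extend : X^t* *m X = 1%:M.
Proof.
rewrite XC mul_col_row vv -!mulmxA Tv mulmx0 (mulmxA (v^t*)) vT mul0mx.
by rewrite (mulmxA (T^t*)) TT mul1mx YY -scalar_mx_block.
Qed.

(** [J] and [u] are the coordinate inclusions into [chi + 1]; in the coordinates given by [X] they
    take the places of [T *m Y] and [v]. *)
Let J : 'M[C]_(chi + 1, chi) := col_mx 1%:M 0.
Let u : 'cV[C]_(chi + 1) := col_mx 0 1%:M.

Let JC : J^t* = row_mx 1%:M 0.
Proof. by rewrite tr_col_mx map_row_mx trmx1 map_mx1 trmx0 map_mx0. Qed.

Let uC : u^t* = row_mx 0 1%:M.
Proof. by rewrite tr_col_mx map_row_mx trmx1 map_mx1 trmx0 map_mx0. Qed.

Let JJ : J^t* *m J = 1%:M.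
Proof. by rewrite JC mul_row_col !mul1mx mul0mx addr0. Qed.

Let uu : u^t* *m u = 1%:M.
Proof. by rewrite uC mul_row_col mulmx0 mul1mx add0r. Qed.

Let KX (w : family_index) : 'M[C]_(chi + 1) :=
  match w with
  | inl (inl (inl i)) => a *: (J *m K i *m J^t*)
  | inl (inl (inr p)) => b *: (u *m (row p.2 (A p.1) *m Y) *m J^t*)
  | inl (inr p) => g *: (J *m (Y^t* *m col p.2 (A p.1)) *m u^t*)
  | inr _ => e *: (u *m u^t*)
  end.

Let KXE w : X^t* *m mps_family w *m X = KX w.
Proof.
have XT : X^t* *m T = J *m Y^t*.
  by rewrite XC !mul_col_mx vT -mulmxA TT mulmx1 mul1mx mul0mx.
have TX : T^t* *m X = Y *m J^t*.
  by rewrite JC !mul_mx_row Tv mulmxA TT mul1mx mulmx1 mulmx0.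
have Xv : X^t* *m v = u.
  by rewrite XC mul_col_mx vv -mulmxA Tv mulmx0.
have vX : v^t* *m X = u^t*.
  by rewrite uC mul_mx_row vv mulmxA vT mul0mx.
case: w => [[[i|p]|p]|[]] /=; rewrite -scalemxAr -scalemxAl; congr (_ *: _).
- by rewrite /K !mulmxA XT -!mulmxA TX.
- by rewrite !mulmxA Xv -!mulmxA TX.
- by rewrite !mulmxA XT -!mulmxA vX.
- by rewrite !mulmxA Xv -!mulmxA vX.
Qed.

(** Each matrix ends in [T^t*] or [v^t*]. In the first case the factor before it is [A i] or one of
    its rows, which absorbs [Y *m Y^t*]. *)
Lemma family_extend w : mps_family w *m (X *m X^t*) = mps_family w.
Proof.
have XX : X *m X^t* = T *m (Y *m Y^t*) *m T^t* + v *m v^t*.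
  by rewrite XC mul_row_col !mulmxA.
have TX : T^t* *m (X *m X^t*) = Y *m Y^t* *m T^t*.
  by rewrite XX mulmxDr !mulmxA TT Tv mul0mx addr0 mul1mx.
have vX : v^t* *m (X *m X^t*) = v^t*.
  by rewrite XX mulmxDr !mulmxA vT vv !mul0mx add0r mul1mx.
case: w => [[[i|p]|p]|[]] /=; rewrite -scalemxAl; congr (_ *: _).
- by rewrite -mulmxA TX !mulmxA -[T *m _ *m Y *m _]mulmxA -(mulmxA T) AY.
- by rewrite -mulmxA TX mulmxA -[_ *m (Y *m _)]mulmxA -row_mul AY.
- by rewrite -mulmxA vX.
- by rewrite -mulmxA vX.
Qed.

Let row_sum_adj (R : 'rV[C]_D) :
  R *m R^t* = (\sum_l R 0 l * (R 0 l)^*)%:M.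
Proof.
rewrite [LHS]mx11_scalar; congr (_%:M); rewrite mxE.
by apply: eq_bigr => l _; rewrite !mxE.
Qed.

Let col_sum_adj (B : 'M[C]_D) : \sum_l col l B *m (col l B)^t* = B *m B^t*.
Proof.
apply/matrixP => i k; rewrite summxE mxE; apply: eq_bigr => l _.
by rewrite mxE big_ord1 !mxE.
Qed.

(** The matrices with [a] and those with [g] contribute [|a|^2] and [|g|^2] times the projection
    onto the first [chi] coordinates: for the columns, summing [col l B *m (col l B)^t*] over [l]
    gives back [B *m B^t*]. The rows and the last matrix contribute [|b|^2 N] and [|e|^2] times the
    projection onto [u]. *)
Lemma normalized_extend : normalized (fun w => X^t* *m mps_family w *m X).
Proof.
rewrite /normalized (eq_bigr (fun w => KX w *m (KX w)^t*)) => [|w _]; last by rewrite KXE.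
have adjE p q (P : 'M[C]_(chi + 1, p)) (Q : 'M[C]_(chi + 1, q)) c B :
    Q^t* *m Q = 1%:M ->
    (c *: (P *m B *m Q^t*)) *m (c *: (P *m B *m Q^t*))^t* =
    (c * c^*) *: (P *m (B *m B^t*) *m P^t*).
  move=> QQ; rewrite linearZ /= map_mxZ -scalemxAl -scalemxAr scalerA.
  by rewrite !trmxC_mul trmxCK !mulmxA -[_ *m Q^t* *m Q]mulmxA QQ mulmx1 .
have YYA i : A i *m Y *m Y^t* = A i by rewrite -mulmxA AY.
rewrite big_family /=.
rewrite (eq_bigr (fun i => (a * a^*) *: (J *m (K i *m (K i)^t*) *m J^t*))); last first.
  by move=> i _; rewrite adjE.
rewrite -scaler_sumr -mulmx_suml -mulmx_sumr nK mulmx1.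
rewrite (eq_bigr (fun i => (b * b^*) *:
    (u *m (\sum_k \sum_l A i k l * (A i k l)^*)%:M *m u^t*))); last first.
  move=> i _; rewrite raddf_sum mulmx_sumr mulmx_suml scaler_sumr.
  apply: eq_bigr => k _; rewrite adjE // trmxC_mul [row _ _ *m Y *m _]mulmxA.
  rewrite -2!row_mul YYA row_sum_adj; congr (_ *: (_ *m _%:M *m _)).
  by apply: eq_bigr => l _; rewrite !mxE.
rewrite -scaler_sumr -mulmx_suml -mulmx_sumr -raddf_sum /=.
rewrite [X in _ + _ + X + _](eq_bigr (fun i => (g * g^*) *:
    (J *m (K i *m (K i)^t*) *m J^t*))); last first.
  move=> i _; rewrite (eq_bigr (fun l => (g * g^*) *: (J *m (Y^t* *m
      (col l (A i) *m (col l (A i))^t*) *m Y) *m J^t*))); last first.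
    by move=> l _; rewrite adjE // trmxC_mul trmxCK !mulmxA.
  rewrite -scaler_sumr -mulmx_suml -mulmx_sumr -mulmx_suml -mulmx_sumr col_sum_adj.
  have YYAr p (Z : 'M[C]_(D, p)) : A i *m (Y *m (Y^t* *m Z)) = A i *m Z.
    by rewrite !mulmxA YYA.
  by rewrite /K !trmxC_mul trmxCK -!mulmxA YYAr.
rewrite -scaler_sumr -mulmx_suml -mulmx_sumr nK mulmx1.
rewrite linearZ /= map_mxZ -scalemxAl -scalemxAr scalerA trmxC_mul trmxCK.
rewrite mulmxA -[u *m _ *m u]mulmxA uu mulmx1.
rewrite mul_mx_scalar -scalemxAl scalerA -addrA addrACA -!scalerDl ag be !scale1r.
rewrite JC uC !mul_col_row !mul1mx !mul0mx add_block_mx !addr0 !add0r.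
by rewrite -scalar_mx_block.
Qed.

Hypotheses (nz : [&& a != 0, b != 0, g != 0 & e != 0]) (chi_gt0 : (0 < chi)%N).

(** The four kinds of matrices span the four blocks of [M] separately. *)
Lemma spanning_extend : spanning (fun w => X^t* *m mps_family w *m X).
Proof.
move=> M; case/and4P: nz => a0 b0 g0 e0.
pose r0 := Ordinal chi_gt0.
have [x1 x1E] := sK (ulsubmx M).
(* The row block becomes row [r0] of a square matrix, to which [sK] applies; row [r0] of [K i] is a
   combination of the rows of [A i], followed by [Y]. The column block is treated in the same way
   with column [r0]. *)
have [x2 x2E] := sK (delta_mx r0 0 *m dlsubmx M).
have [x3 x3E] := sK (ursubmx M *m delta_mx 0 r0).
exists (fun w : family_index => match w with
  | inl (inl (inl i)) => x1 i / a
  | inl (inl (inr p)) => x2 p.1 * (Y^t*) r0 p.2 / b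
  | inl (inr p) => x3 p.1 * Y p.2 r0 / g
  | inr _ => drsubmx M 0 0 / e end).
rewrite (eq_bigr (fun w : family_index => match w with
  | inl (inl (inl i)) => J *m (x1 i *: K i) *m J^t*
  | inl (inl (inr p)) => u *m
     (x2 p.1 *: ((Y^t*) r0 p.2 *: row p.2 (A p.1)) *m Y) *m J^t*
  | inl (inr p) => J *m (Y^t* *m (x3 p.1 *: (Y p.2 r0 *: col p.2 (A p.1)))) *m u^t*
  | inr _ => u *m drsubmx M *m u^t* end)); last first.
  move=> w _; rewrite KXE; case: w => [[[i|p]|p]|[]] /=; rewrite scalerA divfK //.
  - by rewrite -scalemxAr -scalemxAl.
  - by rewrite -!(scalemxAr, scalemxAl) scalerA.
  - by rewrite -!(scalemxAr, scalemxAl) scalerA.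
  - by rewrite [drsubmx M]mx11_scalar mul_mx_scalar -scalemxAl mxE.
rewrite big_family /= -mulmx_suml -mulmx_sumr -x1E.
have rowsE : \sum_i \sum_k u *m (x2 i *: ((Y^t*) r0 k *: row k (A i)) *m Y) *m J^t* =
    u *m dlsubmx M *m J^t*.
  have -> : dlsubmx M = row r0 (\sum_i x2 i *: K i).
    rewrite -x2E; move: (dlsubmx M) => B; apply/matrixP => p q.
    by rewrite !mxE big_ord1 !mxE !eqxx mul1r ord1.
  rewrite linear_sum mulmx_sumr mulmx_suml; apply: eq_bigr => i _.
  rewrite -mulmx_suml -mulmx_sumr -mulmx_suml -scaler_sumr linearZ /= !row_mul.
  rewrite [row r0 _ *m A i]mulmx_sum_row scalemxAl.
  by under [in RHS]eq_bigr do rewrite [row r0 _ _ _]mxE.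
have colsE : \sum_i \sum_l J *m (Y^t* *m (x3 i *: (Y l r0 *: col l (A i)))) *m u^t* =
    J *m ursubmx M *m u^t*.
  have -> : ursubmx M = col r0 (\sum_i x3 i *: K i).
    rewrite -x3E; move: (ursubmx M) => B; apply/matrixP => p q.
    by rewrite !mxE big_ord1 !mxE !eqxx mulr1 ord1.
  rewrite linear_sum mulmx_sumr mulmx_suml; apply: eq_bigr => i _.
  rewrite -mulmx_suml -!mulmx_sumr -scaler_sumr linearZ /=; congr (_ *m _ *m _).
  rewrite [RHS]linearZ /=; congr (_ *: _); rewrite [RHS]colE -!mulmxA -colE; congr (_ *m _).
  apply/matrixP => p q; rewrite summxE !mxE; apply: eq_bigr => l _.
  by rewrite !mxE mulrC.
rewrite rowsE colsE JC uC /J /u !mul_col_mx !mul_mx_row -!/(block_mx _ _ _ _).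
rewrite !mul1mx !mul0mx !mulmx0 !mulmx1.
by rewrite !add_block_mx !addr0 !add0r submxK.
Qed.

End Interpolation.

(** * The deformed arrays *)

Section Arrays.
Variable C : numClosedFieldType.

Lemma array_finite d D (x : nat -> nat -> nat -> C) :
  (forall i a b, [|| d <= i, D <= a | D <= b]%N -> x i a b = 0) ->
  x \in [set A : nat -> nat -> nat -> C |
    finite_set [set p : nat * nat * nat | A p.1.1 p.1.2 p.2 != 0]].
Proof.
move=> x0; rewrite inE /=.
apply: (@sub_finite_set _ _ (`I_d `*` `I_D `*` `I_D)); last first.
  by do 2?apply: finite_setX; exact: finite_II.
move=> [[i a] b] /= xN0; split; first split; rewrite /= ltnNge; apply: contra_neqN xN0 => h;
  by apply: x0; rewrite h ?orbT.
Qed.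

Definition array d D x x0 : Marr C := exist _ x (@array_finite d D x x0).

End Arrays.

(** Index [0] is kept for [e_0 e_0^*] and the odd indices for the shifted [A^i]; rows and columns
    share the positive even ones, told apart by the boolean. The labels do not involve [d] and [D],
    as gluing over all levels requires. *)
Definition row_label (i k : nat) : nat := (pickle (true, i, k)).*2.+2.
Definition col_label (i l : nat) : nat := (pickle (false, i, l)).*2.+2.

Definition new_phys d D : nat :=
  (d.*2 + \max_(w : 'I_d * 'I_D) maxn (row_label w.1 w.2) (col_label w.1 w.2)).+1.
Definition new_bond D : nat := D.*2.+1.

Section Deformation.
Variable C : numClosedFieldType.
Variables (V : nat -> nat -> C) (a b g e : C).

(** For fixed coefficients the deformation is affine in the entries of [A], with coefficients free
    of [d] and [D]. [V] moves the physical index and both bond indices in the first term. *)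
Definition deform_coef (n x y i k l : nat) : C :=
  a * (V i n * (V k x * V l y)) +
  b * ((n == row_label i k)%:R * ((x == 0)%N%:R * V l y)) +
  g * ((n == col_label i l)%:R * (V k x * (y == 0)%N%:R)).

Definition deform d D (A : nat -> nat -> nat -> C) (n x y : nat) : C :=
  \sum_(i < d) \sum_(k < D) \sum_(l < D) deform_coef n x y i k l * A i k l +
  e * ((n == 0) && (x == 0) && (y == 0))%N%:R.

Hypothesis Vfin : forall k x, (k.*2.+1 < x)%N -> V k x = 0.

Lemma label_bound d D (i : 'I_d) (k : 'I_D) :
  (row_label i k < new_phys d D)%N /\ (col_label i k < new_phys d D)%N.
Proof.
rewrite /new_phys; set M := (\max_w _).
have : (maxn (row_label i k) (col_label i k) <= M)%N.
  exact: (leq_bigmax (F := fun w : 'I_d * 'I_D =>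
    maxn (row_label w.1 w.2) (col_label w.1 w.2)) (i, k)).
by rewrite geq_max => /andP[]; move: M => M; lia.
Qed.

Lemma deform_bounded d D A n x y :
  [|| new_phys d D <= n, new_bond D <= x | new_bond D <= y]%N ->
  deform d D A n x y = 0.
Proof.
move=> nxy; rewrite /deform big1 => [|i _].
  rewrite add0r (_ : (_ && _ && _) = false) ?mulr0 //.
  by case/or3P: nxy; rewrite /new_phys /new_bond; case: n x y => [|n] [|x] [|y].
rewrite big1 // => k _; rewrite big1 // => l _.
have [h1 _] := label_bound i k; have [_ h2] := label_bound i l.
have hi := ltn_ord i; have hk := ltn_ord k; have hl := ltn_ord l.
suff -> : deform_coef n x y i k l = 0 by rewrite mul0r.
rewrite /deform_coef; case/or3P: nxy; rewrite /new_bond => h.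
- rewrite (Vfin (k := i)) ?(gtn_eqF (leq_trans h1 h)) ?(gtn_eqF (leq_trans h2 h));
    last by rewrite /new_phys in h; lia.
  by rewrite !mul0r !mulr0 !addr0.
- rewrite (Vfin (k := k)); last lia.
  by rewrite (_ : (x == 0)%N = false) ?mul0r ?mulr0 ?addr0 ?mul0r ?mulr0 ?addr0 //; lia.
- rewrite (Vfin (k := l)); last lia.
  by rewrite (_ : (y == 0)%N = false) ?mul0r ?mulr0 ?addr0 ?mul0r ?mulr0 ?addr0 //; lia.
Qed.

Definition deform_array d D (A : Marr C) : Marr C :=
  array (@deform_bounded d D (entry A)).

Lemma deform_Mbd d D A : Mbd (new_phys d D) (new_bond D) (deform_array d D A).
Proof. by move=> n x y; exact: deform_bounded. Qed.

Hypothesis VR : forall k x, (V k x)^* = V k x.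
Hypothesis Viso : forall N k l, (k.*2.+1 < N)%N -> (l.*2.+1 < N)%N ->
  \sum_(x < N) V k x * V l x = (k == l)%:R.

Section Fixed.
Variables (d D : nat) (A : Marr C).
Let B := deform_array d D A.
Let A_ := corner D A : 'I_d -> 'M[C]_D.
Let T : 'M[C]_(new_bond D, D) := \matrix_(x, k) V k x.
Let v : 'cV[C]_(new_bond D) := delta_mx 0 0.

Lemma corner_deform (n : 'I_(new_phys d D)) :
  corner (new_bond D) B n =
    a *: (\sum_(i < d) V i n *: (T *m A_ i *m T^t*)) +
    b *: (\sum_(i < d) \sum_(k < D) (n == row_label i k :> nat)%:R *:
            (v *m row k (A_ i) *m T^t*)) +
    g *: (\sum_(i < d) \sum_(l < D) (n == col_label i l :> nat)%:R *:
            (T *m col l (A_ i) *m v^t*)) +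
    (e * (n == 0 :> nat)%N%:R) *: (v *m v^t*).
Proof.
have TM p (M : 'M[C]_(p, D)) (P : 'M[C]_(new_bond D, p)) (x y : 'I_(new_bond D)) :
    (P *m M *m T^t*) x y = \sum_l \sum_q P x q * M q l * V l y.
  rewrite mxE; apply: eq_bigr => l _; rewrite !mxE VR mulr_suml.
  by apply: eq_bigr => q _.
have vE (x : 'I_(new_bond D)) i : v x i = (x == 0 :> nat)%N%:R.
  by rewrite mxE ord1 eqxx andbT.
have vCE i (x : 'I_(new_bond D)) : (v^t*) i x = (x == 0 :> nat)%N%:R.
  by rewrite !mxE ord1 eqxx andbT conjC_nat.
apply/matrixP => x y; rewrite [LHS]mxE /entry /= /deform -/(entry A).
transitivity (
  a * (\sum_(i < d) \sum_(l < D) \sum_(k < D) V i n * (V k x * entry A i k l * V l y)) +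
  b * (\sum_(i < d) \sum_(k < D) \sum_(l < D)
        (n == row_label i k :> nat)%:R * ((x == 0 :> nat)%N%:R * entry A i k l * V l y)) +
  g * (\sum_(i < d) \sum_(l < D) \sum_(k < D)
        (n == col_label i l :> nat)%:R * (V k x * entry A i k l * (y == 0 :> nat)%N%:R)) +
  e * (n == 0 :> nat)%N%:R * ((x == 0 :> nat)%N%:R * (y == 0 :> nat)%N%:R)).
  congr (_ + _); last by rewrite -!mulnb !natrM !mulrA.
  rewrite !mulr_sumr -!big_split; apply: eq_bigr => i _ /=.
  rewrite [X in a * X]exchange_big [X in g * X]exchange_big /=.
  rewrite !mulr_sumr -!big_split; apply: eq_bigr => k _ /=.
  rewrite !mulr_sumr -!big_split; apply: eq_bigr => l _ /=.
  rewrite /deform_coef; ring.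
rewrite !mxE !summxE; congr (_ + _ + _ + _).
- congr (_ * _); apply: eq_bigr => i _; rewrite mxE TM mulr_sumr.
  apply: eq_bigr => l _; rewrite mulr_sumr; apply: eq_bigr => k _.
  by rewrite !mxE.
- congr (_ * _); apply: eq_bigr => i _; rewrite summxE; apply: eq_bigr => k _.
  rewrite mxE TM mulr_sumr; apply: eq_bigr => l _.
  by rewrite big_ord1 vE !mxE.
- congr (_ * _); apply: eq_bigr => i _; rewrite summxE; apply: eq_bigr => l _.
  rewrite mxE mxE big_ord1 mxE !mulr_suml mulr_sumr.
  apply: eq_bigr => k _; rewrite vCE !mxE; ring.
- by rewrite big_ord1 vE vCE.
Qed.

Let TT : T^t* *m T = 1%:M.
Proof.
apply/matrixP => k l; rewrite !mxE; have hk := ltn_ord k; have hl := ltn_ord l.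
rewrite -[k == l]/(k == l :> nat) -(@Viso (new_bond D)); try (rewrite /new_bond; lia).
by apply: eq_bigr => x _; rewrite !mxE VR.
Qed.

Let vv : v^t* *m v = 1%:M.
Proof.
rewrite /v trmx_delta map_delta_mx mul_delta_mx.
by apply/matrixP => x y; rewrite !mxE !ord1.
Qed.

(** Serves two stages: moving [V] while [b = 0], and increasing [b] once [V] avoids index [0]. In
    the second, [v] is orthogonal to the range of [T], so the new rows land in the arbitrary block.
    In both, the compression is that of [A], mixed by the isometry [V] of physical indices. *)
Lemma Ebond_deform_isometry chi :
    a = 1 -> g = 0 -> e = 0 -> (forall k, b * V k 0 = 0) -> Ebond d D chi A ->
  Ebond (new_phys d D) (new_bond D) chi B.
Proof.
move=> a1 g0 e0 bV0 /Ebond_elim[Y [YY AY nK sK]].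
have Tv : b *: (T^t* *m v) = 0.
  apply/matrixP => k x; rewrite !ord1 !mxE big_distrr big1 //= => y _.
  by rewrite !mxE VR; case: (altP (y =P 0)) => [->|_]; rewrite ?mulr0 //= mulr1 bV0.
have GE (n : 'I_(new_phys d D)) : corner (new_bond D) B n =
    \sum_(i < d) V i n *: (T *m A_ i *m T^t*) + b *: (v *m
      \sum_(i < d) \sum_(k < D) (n == row_label i k :> nat)%:R *: (row k (A_ i) *m T^t*)).
  rewrite corner_deform a1 g0 e0 mul0r !scale0r scale1r !addr0; congr (_ + _ *: _).
  rewrite mulmx_sumr; apply: eq_bigr => i _; rewrite mulmx_sumr.
  by apply: eq_bigr => k _; rewrite -scalemxAr mulmxA.
have Y'C : (T *m Y)^t* = Y^t* *m T^t* by exact: trmxC_mul.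
have [nG sG] : normalized (fun n : 'I_(new_phys d D) =>
      (T *m Y)^t* *m corner (new_bond D) B n *m (T *m Y)) /\
    spanning (fun n : 'I_(new_phys d D) => (T *m Y)^t* *m corner (new_bond D) B n *m (T *m Y)).
  refine (isometric_family (S := fun (n : 'I_(new_phys d D)) (i : 'I_d) => V i n)
    _ _ (conj nK sK)) => [i i'|n].
    have hi := ltn_ord i; have hi' := ltn_ord i'.
    rewrite -[i == i']/(i == i' :> nat) -(@Viso (new_phys d D)); try (rewrite /new_phys; lia).
    by apply: eq_bigr => n _; rewrite VR.
  have Tv0 (W : 'M[C]_(1, new_bond D)) : T^t* *m (b *: (v *m W)) = 0.
    by rewrite -scalemxAr mulmxA scalemxAl Tv mul0mx.
  rewrite GE Y'C mulmxDr mulmxDl -[Y^t* *m T^t* *m (b *: _)]mulmxA Tv0.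
  rewrite mulmx0 mul0mx addr0.
  rewrite mulmx_sumr mulmx_suml; apply: eq_bigr => i _.
  rewrite -scalemxAr -scalemxAl; congr (_ *: _).
  rewrite !mulmxA -[Y^t* *m T^t* *m T]mulmxA TT mulmx1.
  by rewrite -[Y^t* *m A_ i *m T^t* *m T]mulmxA TT mulmx1.
apply: (@Ebond_intro _ _ _ _ _ (T *m Y)) => //.
- exact: deform_Mbd.
- by rewrite Y'C mulmxA -(mulmxA (Y^t*)) TT mulmx1.
- move=> n; have YT : T^t* *m (T *m Y *m (T *m Y)^t*) = Y *m Y^t* *m T^t*.
    by rewrite Y'C !mulmxA TT mul1mx.
  rewrite GE mulmxDl; congr (_ + _).
    rewrite mulmx_suml; apply: eq_bigr => i _.
    by rewrite -scalemxAl -mulmxA YT mulmxA -(mulmxA T) AY.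
  rewrite -scalemxAl -(mulmxA v) mulmx_suml; congr (_ *: (_ *m _)).
  apply: eq_bigr => i _; rewrite mulmx_suml; apply: eq_bigr => k _.
  by rewrite -scalemxAl -mulmxA YT mulmxA -row_mul AY.
Qed.

Hypothesis Vshift : forall k x, V k x = (x == k.*2.+1)%:R.

Let Tv : T^t* *m v = 0.
Proof.
apply/matrixP => k x; rewrite !ord1 !mxE big1 //= => y _.
by rewrite !mxE VR Vshift; case: (altP (y =P 0)) => [->|_]; rewrite ?mulr0 ?mul0r.
Qed.

Definition label (w : family_index d D) : nat :=
  match w with
  | inl (inl (inl i)) => i.*2.+1
  | inl (inl (inr p)) => row_label p.1 p.2
  | inl (inr p) => col_label p.1 p.2
  | inr _ => 0
  end.

Lemma label_inj : injective label.
Proof.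
have pI (x y : bool * nat * nat) : (pickle x).*2.+2 = (pickle y).*2.+2 -> x = y.
  by move=> [] /double_inj /(pcan_inj pickleK).
have E (i : 'I_d) (x : bool * nat * nat) : i.*2.+1 <> (pickle x).*2.+2 by lia.
move=> [[[i|[i k]]|[i k]]|[]] [[[i'|[i' k']]|[i' k']]|[]] //=; rewrite /row_label /col_label.
- by move=> [] /double_inj /val_inj ->.
- by move=> /E.
- by move=> /E.
- by move/esym=> /E.
- by move=> /pI[] /val_inj -> /val_inj ->.
- by move=> /pI.
- by move/esym=> /E.
- by move=> /pI.
- by move=> /pI[] /val_inj -> /val_inj ->.
Qed.

Lemma label_lt w : (label w < new_phys d D)%N.
Proof.
case: w => [[[i|[i k]]|[i k]]|[]] //=.
- by have := ltn_ord i; rewrite /new_phys; lia.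
- by have [] := label_bound i k.
- by have [] := label_bound i k.
Qed.

(** Distributing the family over distinct physical indices, with zero matrices elsewhere, is a case
    of [isometric_family] with a 0-1 matrix. *)
Lemma Ebond_family chi (X : 'M[C]_(new_bond D, chi)) :
  let f := mps_family A_ T v a b g e in
  X^t* *m X = 1%:M -> (forall w, f w *m (X *m X^t*) = f w) ->
  normalized (fun w => X^t* *m f w *m X) -> spanning (fun w => X^t* *m f w *m X) ->
  Ebond (new_phys d D) (new_bond D) chi B.
Proof.
move=> f XX fX nf sf.
have GE (n : 'I_(new_phys d D)) :
    corner (new_bond D) B n = \sum_w (n == label w :> nat)%:R *: f w.
  rewrite corner_deform big_family /= !scaler_sumr; congr (_ + _ + _ + _).
  - by apply: eq_bigr => i _; rewrite Vshift !scalerA mulrC.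
  - apply: eq_bigr => i _; rewrite scaler_sumr.
    by apply: eq_bigr => k _; rewrite !scalerA mulrC.
  - apply: eq_bigr => i _; rewrite scaler_sumr.
    by apply: eq_bigr => k _; rewrite !scalerA mulrC.
  - by rewrite scalerA mulrC.
have [nG sG] : normalized (fun n : 'I_(new_phys d D) => X^t* *m corner (new_bond D) B n *m X) /\
    spanning (fun n : 'I_(new_phys d D) => X^t* *m corner (new_bond D) B n *m X).
  refine (isometric_family
    (S := fun (n : 'I_(new_phys d D)) w => (n == label w :> nat)%:R) _ _ (conj nf sf)).
    move=> w w'; rewrite (bigD1 (Ordinal (label_lt w))) //= eqxx mul1r conjC_nat.
    rewrite (inj_eq label_inj) big1 ?addr0 // => n.
    by rewrite -val_eqE /= => /negPf ->; rewrite mul0r.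
  move=> n; rewrite GE mulmx_sumr mulmx_suml; apply: eq_bigr => w _.
  by rewrite -scalemxAr -scalemxAl.
apply: (@Ebond_intro _ _ _ _ _ X) => //.
- exact: deform_Mbd.
- move=> n; rewrite GE mulmx_suml; apply: eq_bigr => w _.
  by rewrite -scalemxAl fX.
Qed.

Lemma Ebond_deform_vector :
  a = 0 -> b = 0 -> e = 1 -> Ebond (new_phys d D) (new_bond D) 1 B.
Proof.
move=> a0 b0 e1; have [fv nf sf] := family_vector A_ g vv Tv a0 b0 e1.
exact: (Ebond_family vv).
Qed.

Lemma Ebond_deform_extend chi : (0 < chi)%N -> Ebond d D chi A ->
  a * a^* + g * g^* = 1 ->
  b * b^* * (\sum_(i < d) \sum_(k < D) \sum_(l < D) entry A i k l * (entry A i k l)^*)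
    + e * e^* = 1 ->
  [&& a != 0, b != 0, g != 0 & e != 0] ->
  Ebond (new_phys d D) (new_bond D) (chi + 1) B.
Proof.
move=> chi_gt0 /Ebond_elim[Y [YY AY nK sK]] ag be nz.
have be' : b * b^* * (\sum_i \sum_k \sum_l A_ i k l * (A_ i k l)^*) + e * e^* = 1.
  rewrite -[RHS]be; congr (_ * _ + _).
  by do 3![apply: eq_bigr => ? _]; rewrite !mxE.
apply: (@Ebond_family _ (row_mx (T *m Y) v)).
- exact: isometry_extend.
- exact: family_extend.
- exact: normalized_extend.
- exact: spanning_extend.
Qed.

End Fixed.
End Deformation.

(** * Topology of the colimit *)

(* Whitehead: the compactness of segments makes the product with [R] preserve
   the final topology. *)
Lemma final_prod_continuous (R : realType) (I : Type) (X : I -> topologicalType)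
    (S : choiceType) (f : forall i, X i -> S) (Z : topologicalType)
    (H : final_topology f * R -> Z) :
  (forall s : S, exists i x, f i x = s) ->
  (forall i, continuous (fun p : X i * R => H (f i p.1, p.2))) ->
  continuous H.
Proof.
move=> fsurj Hf [s t] /= U; rewrite nbhsE => -[G [oO OH] OU].
have [i [x xs]] := fsurj s; subst s.
have oHf j : open [set p : X j * R | G (H (f j p.1, p.2))].
  by have /continuousP := Hf j; apply.
have [r r0 rO] : exists2 r : R, 0 < r &
    forall t', `|t - t'| <= r -> G (H (f i x, t')).
  have /(open_nbhs_nbhs)/= : open_nbhs (x, t) [set p : X i * R | G (H (f i p.1, p.2))].
    by split.
  case=> -[P Q] /= [Px /nbhs_ballP[r /= r0 rQ]] PQ.
  exists (r / 2); first by rewrite divr_gt0.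
  move=> t' tt'; apply: (PQ (x, t')); split => /=; first exact: nbhs_singleton.
  by apply: rQ; apply: le_lt_trans tt' _; rewrite ltr_pdivrMr // ltr_pMr // ltr1n.
pose K := `[t - r, t + r]%classic : set R.
have KE t' : K t' <-> `|t - t'| <= r.
  by rewrite /K /= in_itv /= ler_distlC.
(* The tube lemma, applied at every level [j] with the same segment [K], shows that [W] is open in
   the final topology; a neighbourhood found at level [i] alone would not be. *)
pose W : set (final_topology f) := [set s | K `<=` [set t' | G (H (s, t'))]].
have oW : open W.
  move=> j; rewrite openE => y Wy; rewrite /interior /=.
  have /compact_near_coveringP := @segment_compact R (t - r) (t + r).
  move=> /(_ _ (nbhs y) (fun y' t' => G (H (f j y', t')))); apply => t' Kt'.
  have : nbhs (y, t') [set p : X j * R | G (H (f j p.1, p.2))].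
    by apply: open_nbhs_nbhs; split => //; exact: Wy.
  case=> -[P Q] /= [Py Qt'] PQ; exists (Q, P) => //= -[t'' y''] /= [Qt'' Py''].
  exact: (PQ (y'', t'')).
apply: filterS OU _; exists (W, K) => /=; last first.
  by move=> [s t'] /= [Ws Kt']; exact: Ws.
split; last by apply/nbhs_ballP; exists r => // t' tt'; apply/KE/ltW.
by apply: open_nbhs_nbhs; split => // t' /KE; exact: rO.
Qed.

Lemma ptws_mx_continuous (Z : topologicalType) (I : Type) (T : topologicalType)
    m n (f : Z -> {ptws I -> 'M[T]_(m, n)}) :
  (forall i a b, continuous (fun z => f z i a b)) -> continuous f.
Proof.
move=> cf z; apply/cvg_sup => i.
have : continuous (fun z => f z i).
  move=> z' U [P nP PU]; apply: filterS PU _.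
  have : \forall z'' \near z', forall ab : 'I_m * 'I_n, P ab.1 ab.2 (f z'' i ab.1 ab.2).
    apply: filter_forall => -[a b] /=; exact: cf (nP a b).
  by apply: filterS => z'' h a b; exact: (h (a, b)).
move=> ci; apply: (@continuous_comp_initial _ _ _ (fun g : I -> 'M[T]_(m, n) => g i)).
exact: ci.
Qed.

Section Colimit.
Variable C : numClosedFieldType.

Lemma entry_continuous d D (i : 'I_d) (a b : 'I_D) :
  continuous (fun A : Ebd_space C d D => entry (set_val A) i a b).
Proof.
have c1 : continuous (@Ebd_to_Mbd C d D : Ebd_space C d D -> Mbd_space C d D).
  exact: initial_continuous.
have c2 : continuous (corner (C := C) (d := d) D \o set_val :
    Mbd_space C d D -> {ptws 'I_d -> 'M[C]_D}) by exact: initial_continuous.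
have c3 : continuous (fun f : {ptws 'I_d -> 'M[C]_D} => f i).
  exact: (@proj_continuous _ (fun=> 'M[C]_D) i).
move=> A.
have -> : (fun A : Ebd_space C d D => entry (set_val A) i a b) =
    (fun M : 'M[C]_D => M a b) \o (fun f : {ptws 'I_d -> 'M[C]_D} => f i) \o
    (corner (C := C) (d := d) D \o set_val) \o (@Ebd_to_Mbd C d D).
  by apply/funext => B /=; rewrite mxE.
apply: continuous_comp; first exact: c1.
apply: continuous_comp; first exact: c2.
apply: continuous_comp; first exact: c3.
exact: coord_continuous.
Qed.

(** Converse of [entry_continuous]: the nested initial topologies amount to convergence of the
    finitely many entries. *)
Lemma Ebd_space_continuous (Z : topologicalType) d D (f : Z -> Ebd_space C d D) :
  (forall (i : 'I_d) (a b : 'I_D), continuous (fun z => entry (set_val (f z)) i a b)) ->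
  continuous f.
Proof.
move=> cf; apply: continuous_comp_initial; apply: continuous_comp_initial.
apply: ptws_mx_continuous => i a b.
rewrite (_ : (fun _ => _) = (fun z => entry (set_val (f z)) i a b)) //.
by apply/funext => z; rewrite mxE.
Qed.

Lemma Ebd_to_Emps_continuous p :
  continuous (@Ebd_to_Emps C p : _ -> Espace C).
Proof. by apply/continuousP => U; exact. Qed.

Lemma Ebd_to_Emps_surj (s : Emps (C := C)) : exists p A, @Ebd_to_Emps C p A = s.
Proof.
have [p _ Ep] := set_valP s; exists p, (exist _ (set_val s) (mem_set Ep)).
exact: val_inj.
Qed.

End Colimit.

(** * Continuous coefficients and clamped time *)

Section Continuity.
Variables (T : topologicalType) (K : numFieldType).

Lemma cont_add (f g : T -> K) :
  continuous f -> continuous g -> continuous (fun x => f x + g x).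
Proof. by move=> cf cg x; apply: continuousD; [exact: cf|exact: cg]. Qed.

Lemma cont_mul (f g : T -> K) :
  continuous f -> continuous g -> continuous (fun x => f x * g x).
Proof. by move=> cf cg x; apply: continuousM; [exact: cf|exact: cg]. Qed.

Lemma cont_opp (f : T -> K) : continuous f -> continuous (fun x => - f x).
Proof. by move=> cf x; apply: continuousN; exact: cf. Qed.

Lemma cont_cst (k : K) : continuous (fun _ : T => k).
Proof. by move=> x; exact: cvg_cst. Qed.

Lemma cont_sum (I : finType) (F : I -> T -> K) :
  (forall i, continuous (F i)) -> continuous (fun x => \sum_i F i x).
Proof.
move=> cF; apply: continuous_big => [|i _]; last exact: cF.
by move=> x; exact: add_continuous.
Qed.

Lemma cont_inv (f : T -> K) :
  (forall x, f x != 0) -> continuous f -> continuous (fun x => (f x)^-1).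
Proof. by move=> f0 cf x; apply: continuousV; [exact: f0|exact: cf]. Qed.

End Continuity.

Lemma cont_comp (X Y Z : topologicalType) (f : X -> Y) (g : Y -> Z) :
  continuous g -> continuous f -> continuous (fun x => g (f x)).
Proof. by move=> cg cf x; apply: continuous_comp; [exact: cf|exact: cg]. Qed.

Section Clamp.
Variable R : realType.

(** Clamping allows the time to range over all of [R], as in [final_prod_continuous], while each
    stage varies only during its own unit interval. *)
Definition clamp (x : R) : R := Num.max 0 (Num.min 1 x).

Lemma clamp_continuous : continuous clamp.
Proof.
move=> x; apply: continuous_max; first exact: cvg_cst.
by apply: continuous_min; [exact: cvg_cst|exact: cvg_id].
Qed.

Lemma clamp_le0 x : x <= 0 -> clamp x = 0.
Proof. by move=> x0; rewrite /clamp max_l // ge_min x0 orbT. Qed.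

Lemma clamp_ge1 x : 1 <= x -> clamp x = 1.
Proof. by move=> x1; rewrite /clamp min_l // max_r. Qed.

Lemma clamp_ge0 x : 0 <= clamp x.
Proof. by rewrite /clamp le_max lexx. Qed.

Lemma clamp_le1 x : clamp x <= 1.
Proof. by rewrite /clamp ge_max ler01 ge_min lexx. Qed.

Lemma clamp_gt0 x : 0 < clamp x -> 0 < x.
Proof. by apply: contraTT; rewrite -!leNgt => /clamp_le0 ->. Qed.

Lemma clamp_lt1 x : clamp x < 1 -> x < 1.
Proof. by apply: contraTT; rewrite -!leNgt => /clamp_ge1 ->. Qed.

Definition cosine (x : R) : R := Num.sqrt (1 - x ^+ 2).

Lemma cosine_continuous : continuous cosine.
Proof.
apply: (cont_comp (@sqrt_continuous R)); apply: cont_add; first exact: cont_cst.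
by apply: cont_opp; apply: (@cont_mul _ R id id) => x; exact: cvg_id.
Qed.

Lemma cosine0 : cosine 0 = 1.
Proof. by rewrite /cosine expr0n subr0 sqrtr1. Qed.

Lemma cosine1 : cosine 1 = 0.
Proof. by rewrite /cosine expr1n subrr sqrtr0. Qed.

Lemma sqr_cosine x : 0 <= x <= 1 -> cosine x ^+ 2 + x ^+ 2 = 1.
Proof.
by move=> x01; rewrite sqr_sqrtr ?subrK // subr_ge0 expr_le1 //; case/andP: x01.
Qed.

Lemma cosine_neq0 x : 0 <= x < 1 -> cosine x != 0.
Proof.
move=> /andP[x0 x1]; rewrite gt_eqF // sqrtr_gt0 subr_gt0.
by rewrite expr_lt1.
Qed.

End Clamp.

Lemma wcol_rec_continuous (T : topologicalType) (K : numFieldType) (c s : T -> K) :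
  continuous c -> continuous s ->
  forall n k x, continuous (fun t => wcol_rec (c t) (s t) n k x).
Proof.
move=> cc cs; elim=> [|n IH] k x /=; first exact: cont_cst.
case: (odd k); last exact: cont_cst.
apply: (@cont_add _ _ (fun t => c t * _)
  (fun t => - (s t * wcol_rec (c t) (s t) n k./2 x))).
  by apply: cont_mul => //; exact: cont_cst.
by apply: (@cont_opp _ _ (fun t => s t * _)); apply: cont_mul => //; exact: IH.
Qed.

Lemma isocol_continuous (T : topologicalType) (K : numFieldType) (c s : T -> K) k x :
  continuous c -> continuous s -> continuous (fun t => isocol (c t) (s t) k x).
Proof.
move=> cc cs; 
apply: (@cont_add _ _ (fun t => c t * wcol (c t) (s t) k x) (fun t => s t * _));
  apply: cont_mul => //; last exact: cont_cst.
exact: wcol_rec_continuous.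
Qed.

Lemma eq_sum3 (V : nmodType) (f : nat -> nat -> nat -> V) d D d' D' :
  (forall i k l, [|| d <= i, D <= k | D <= l]%N -> f i k l = 0) ->
  (forall i k l, [|| d' <= i, D' <= k | D' <= l]%N -> f i k l = 0) ->
  \sum_(i < d) \sum_(k < D) \sum_(l < D) f i k l =
  \sum_(i < d') \sum_(k < D') \sum_(l < D') f i k l.
Proof.
have widen n m (g : nat -> V) : (n <= m)%N -> (forall i, (n <= i)%N -> g i = 0) ->
    \sum_(i < n) g i = \sum_(i < m) g i.
  move=> nm g0; rewrite (big_ord_widen m g nm) big_mkcond; apply: eq_bigr => i _.
  by case: ltnP => // /g0.
have widen3 n N m M : (n <= m)%N -> (N <= M)%N ->
    (forall i k l, [|| n <= i, N <= k | N <= l]%N -> f i k l = 0) ->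
    \sum_(i < n) \sum_(k < N) \sum_(l < N) f i k l =
    \sum_(i < m) \sum_(k < M) \sum_(l < M) f i k l.
  move=> nm NM f0; rewrite (widen n m (fun i => \sum_(k < N) \sum_(l < N) f i k l)) //.
    apply: eq_bigr => i _; rewrite (widen N M (fun k => \sum_(l < N) f i k l)) //.
      apply: eq_bigr => k _; apply: (widen N M (fun l => f i k l)) => // l Nl.
      by rewrite f0 // Nl !orbT.
    by move=> k Nk; rewrite big1 // => l _; rewrite f0 // Nk orbT.
  by move=> i ni; rewrite big1 // => k _; rewrite big1 // => l _; rewrite f0 // ni.
move=> f0 f0'; rewrite (widen3 d D (maxn d d') (maxn D D')) ?leq_maxl //.
by rewrite [RHS](widen3 d' D' (maxn d d') (maxn D D')) ?leq_maxr.
Qed.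

(** * The contraction *)

Section Contraction.
(** [io] stands for the inclusion of the reals and [nsq] for the squared modulus with values in
    [R]. *)
Variables (R : realType) (C : numClosedFieldType) (io : {rmorphism R -> C}) (nsq : C -> R).
Hypotheses (io_cont : continuous io) (nsq_cont : continuous nsq).
Hypotheses (ioC : forall x, (io x)^* = io x) (nsqE : forall z, io (nsq z) = z * z^*).
Hypothesis nsq_ge0 : forall z, 0 <= nsq z.

Definition shift_cols (u : R) (k x : nat) : C :=
  io (isocol (cosine (clamp u)) (clamp u) k x).

(** This is the sine of the mixing angle rather than the angle itself; [cosine (angle u)] is the
    matching cosine. *)
Definition angle (u : R) : R := clamp (u - 2).

Definition sqnorm d D (A : Marr C) : R :=
  \sum_(i < d) \sum_(k < D) \sum_(l < D) nsq (entry A i k l).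

(** Timetable: the columns shift during [[0, 1]], [b] grows during [[1, 2]], [(a, b)] is traded for
    [(g, e)] during [[2, 3]], and [g] dies out during [[3, 4]]. *)
Definition row_coef (u N : R) : C := io (cosine (angle u) * clamp (u - 1) / Num.sqrt N).
Definition col_coef (u : R) : C := io (angle u * clamp (4 - u)).

Lemma shift_cols_fin u k x : (k.*2.+1 < x)%N -> shift_cols u k x = 0.
Proof. by move=> kx; rewrite /shift_cols isocol_gt // rmorph0. Qed.

Lemma shift_cols_conj u k x : (shift_cols u k x)^* = shift_cols u k x.
Proof. exact: ioC. Qed.

Lemma shift_cols_isometry u N k l : (k.*2.+1 < N)%N -> (l.*2.+1 < N)%N ->
  \sum_(x < N) shift_cols u k x * shift_cols u l x = (k == l)%:R.
Proof.
move=> kN lN.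
rewrite -(rmorph_nat io) -(@dot_isocol_isocol _ (cosine (clamp u)) (clamp u) N) //.
  by rewrite rmorph_sum; apply: eq_bigr => x _; rewrite rmorphM.
by rewrite sqr_cosine // clamp_ge0 clamp_le1.
Qed.

Lemma shift_cols0 k x : shift_cols 0 k x = (x == k)%:R.
Proof. by rewrite /shift_cols clamp_le0 // cosine0 isocol_id rmorph_nat. Qed.

Lemma shift_cols1 u k x : 1 <= u -> shift_cols u k x = (x == k.*2.+1)%:R.
Proof. by move=> u1; rewrite /shift_cols clamp_ge1 // cosine1 isocol_shift rmorph_nat. Qed.

Definition contract d D (A : Marr C) (u : R) : Marr C :=
  deform_array (io (cosine (angle u))) (row_coef u (sqnorm d D A)) (col_coef u)
    (io (angle u)) (@shift_cols_fin u) d D A.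

Lemma sqnormE d D A : io (sqnorm d D A) =
  \sum_(i < d) \sum_(k < D) \sum_(l < D) entry A i k l * (entry A i k l)^*.
Proof. by rewrite rmorph_sum; do 2![apply: eq_bigr => ? _; rewrite rmorph_sum]; apply: eq_bigr. Qed.

(** If all entries vanished, right-normalization would read [0 = 1] in positive dimension [chi].
    This legitimates the division in [row_coef]. *)
Lemma sqnorm_gt0 d D chi A : (0 < chi)%N -> Ebond d D chi A -> 0 < sqnorm d D A.
Proof.
move=> chi_gt0 /Ebond_elim[Y [YY AY nK sK]].
rewrite lt0r; apply/andP; split; last first.
  by do 3![apply: sumr_ge0 => ? _].
apply/negP => /eqP N0.
have A0 (i : 'I_d) : corner D A i = 0.
  apply/matrixP => k l; rewrite !mxE.
  have := N0; move/eqP; rewrite psumr_eq0 => [|? _]; last by do 2![apply: sumr_ge0 => ? _].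
  move=> /allP/(_ i (mem_index_enum _)) /=.
  rewrite psumr_eq0 => [|? _]; last by do 1![apply: sumr_ge0 => ? _].
  move=> /allP/(_ k (mem_index_enum _)) /=.
  rewrite psumr_eq0 // => /allP/(_ l (mem_index_enum _)) /= /eqP n0.
  have := nsqE (entry A i k l); rewrite n0 rmorph0 => /esym/eqP.
  by rewrite mulf_eq0 conjC_eq0 orbb => /eqP.
move: nK; rewrite /normalized big1 => [/matrixP/(_ (Ordinal chi_gt0) (Ordinal chi_gt0))|i _].
  by rewrite !mxE eqxx => /eqP; rewrite eq_sym oner_eq0.
by rewrite A0 mulmx0 mul0mx mul0mx.
Qed.

(** Valid for every array [A]; the zero array thereby supplies the end point of the contraction. *)
Lemma contract_vector d D A u : angle u = 1 ->
  Ebond (new_phys d D) (new_bond D) 1 (contract d D A u).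
Proof.
move=> ph1; have u2 : 2 < u.
  by rewrite -subr_gt0; apply: clamp_gt0; rewrite -/(angle u) ph1.
apply: Ebond_deform_vector.
- exact: shift_cols_conj.
- by move=> k x; apply: shift_cols1; lra.
- by rewrite ph1 cosine1 rmorph0.
- by rewrite /row_coef ph1 cosine1 !mul0r rmorph0.
- by rewrite ph1 rmorph1.
Qed.

(** The bond dimension is [chi] while [angle u = 0], [chi + 1] while it lies strictly between [0]
    and [1], and [1] once it equals [1]. *)
Lemma contract_Ebd d D A u : Ebd d D A -> Ebd (new_phys d D) (new_bond D) (contract d D A u).
Proof.
move=> [chi /= /andP[chi_gt0 _] EA].
suff [chi' chi'_gt0 E'] : exists2 chi', (0 < chi')%N &
    Ebond (new_phys d D) (new_bond D) chi' (contract d D A u).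
  exists chi' => //=; rewrite chi'_gt0; by case: E' => _ [].
have ge0 := clamp_ge0 (u - 2); have le1 := clamp_le1 (u - 2).
have [ph0|ph_neq0] := eqVneq (angle u) 0.
  exists chi => //; apply: Ebond_deform_isometry => //.
  - exact: shift_cols_conj.
  - exact: shift_cols_isometry.
  - by rewrite ph0 cosine0 rmorph1.
  - by rewrite /col_coef ph0 mul0r rmorph0.
  - by rewrite ph0 rmorph0.
  (* Up to time [1] the coefficient [b] is zero; afterwards every column sits at an odd index, hence
     misses [0]. *)
  - move=> k; have [u1|u1] := leP u 1.
      by rewrite /row_coef (@clamp_le0 _ (u - 1)) ?mulr0 ?mul0r ?rmorph0 ?mul0r //; lra.
    by rewrite shift_cols1 ?mulr0 //; exact: ltW.
have ph_gt0 : 0 < angle u by rewrite lt0r ph_neq0.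
have u2 : 2 < u by rewrite -subr_gt0; exact: clamp_gt0.
have [ph1|ph_neq1] := eqVneq (angle u) 1.
  by exists 1%N => //; exact: contract_vector.
have ph_lt1 : angle u < 1 by rewrite lt_neqAle ph_neq1.
have u3 : u < 3 by have := clamp_lt1 ph_lt1; lra.
have N_gt0 := sqnorm_gt0 chi_gt0 EA.
have cs := @sqr_cosine _ (angle u) (introT andP (conj ge0 le1)).
have c0 : cosine (angle u) != 0 by apply: cosine_neq0; rewrite ge0.
have z1 : clamp (4 - u) = 1 by apply: clamp_ge1; lra.
have y1 : clamp (u - 1) = 1 by apply: clamp_ge1; lra.
exists (chi + 1)%N; first by rewrite addn1.
apply: Ebond_deform_extend => //.
- exact: shift_cols_conj.
- exact: shift_cols_isometry.
- by move=> k x; apply: shift_cols1; lra.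
- by rewrite /col_coef z1 mulr1 !ioC -!rmorphM -rmorphD -!expr2 cs rmorph1.
- rewrite -sqnormE /row_coef y1 mulr1 !ioC -!rmorphM -rmorphD /= -[RHS](rmorph1 io) -cs.
  congr (io (_ + _)); rewrite -expr2 expr_div_n.
  rewrite [Num.sqrt (sqnorm _ _ _) ^+ 2]sqr_sqrtr ?(ltW N_gt0) //.
  by rewrite divfK // gt_eqF.
- rewrite /row_coef /col_coef y1 z1 !mulr1 !fmorph_eq0 c0 ph_neq0 mulf_neq0 //.
  by rewrite invr_eq0 sqrtr_eq0 -ltNge.
Qed.

Lemma sqnorm_indep d D d' D' (A : Marr C) :
  Mbd d D A -> Mbd d' D' A -> sqnorm d D A = sqnorm d' D' A.
Proof.
have nsq0 : nsq 0 = 0.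
  by apply: (fmorph_inj io); rewrite nsqE mul0r rmorph0.
move=> AM AM'; apply: (eq_sum3 (f := fun i k l => nsq (entry A i k l))) => i k l h.
  by rewrite AM.
by rewrite AM'.
Qed.

(** An element of [Emps] belongs to many [Ebd d D]; this makes the contraction well defined on their
    union. *)
Lemma contract_indep d D d' D' (A : Marr C) u :
  Mbd d D A -> Mbd d' D' A -> contract d D A u = contract d' D' A u.
Proof.
move=> AM AM'; apply: val_inj => /=; apply/funext => n; apply/funext => x; apply/funext => y.
rewrite /deform (sqnorm_indep AM AM'); congr (_ + _).
apply: (eq_sum3 (f := fun i k l => deform_coef _ _ _ _ n x y i k l * entry A i k l)) => i k l h.
  by rewrite AM // mulr0.
by rewrite AM' // mulr0.
Qed.

Lemma contract0 d D (A : Marr C) : Mbd d D A -> contract d D A 0 = A.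
Proof.
move=> AM; apply: val_inj => /=; apply/funext => n; apply/funext => x; apply/funext => y.
have ph0 : angle 0 = 0 by apply: clamp_le0; lra.
rewrite /deform /col_coef /row_coef ph0 cosine0 (@clamp_le0 _ (0 - 1)); last lra.
rewrite mulr0 !mul0r rmorph0 rmorph1 mul0r addr0.
have pick m j (h : nat -> C) :
    \sum_(i < m) (j == i :> nat)%:R * h i = if (j < m)%N then h j else 0.
  case: ltnP => [jm|mj].
    rewrite (bigD1 (Ordinal jm)) //= eqxx mul1r big1 ?addr0 // => i.
    by rewrite -val_eqE eq_sym /= => /negPf ->; rewrite mul0r.
  rewrite big1 // => i _; rewrite gtn_eqF ?mul0r //.
  exact: leq_trans (ltn_ord i) mj.
transitivity (\sum_(i < d) (n == i :> nat)%:R * \sum_(k < D) (x == k :> nat)%:R *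
    \sum_(l < D) (y == l :> nat)%:R * entry A i k l).
  apply: eq_bigr => i _; rewrite mulr_sumr; apply: eq_bigr => k _.
  rewrite !mulr_sumr; apply: eq_bigr => l _.
  rewrite /deform_coef !shift_cols0; ring.
rewrite (pick d n (fun i => \sum_(k < D) (x == k :> nat)%:R *
    \sum_(l < D) (y == l :> nat)%:R * entry A i k l)).
case: ltnP => [_|dn]; last by rewrite -[RHS]/(entry A n x y) AM // dn.
rewrite (pick D x (fun k => \sum_(l < D) (y == l :> nat)%:R * entry A n k l)).
case: ltnP => [_|Dx]; last by rewrite -[RHS]/(entry A n x y) AM // Dx orbT.
rewrite (pick D y (fun l => entry A n x l)).
by case: ltnP => // Dy; rewrite -[RHS]/(entry A n x y) AM // Dy !orbT.
Qed.

Lemma contract4 d D d' D' (A A' : Marr C) : contract d D A 4 = contract d' D' A' 4.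
Proof.
apply: val_inj => /=; apply/funext => n; apply/funext => x; apply/funext => y.
have ph1 : angle 4 = 1 by apply: clamp_ge1; lra.
rewrite /deform /col_coef /row_coef ph1 cosine1 (@clamp_le0 _ (4 - 4)); last lra.
(* [M] abstracts the square root of [sqnorm], the only trace of [A] in the coefficients; its
   quotient has numerator [0]. *)
have coef0 M i k l : deform_coef (shift_cols 4) (io 0) (io (0 * clamp (4 - 1) / M))
    (io (1 * 0)) n x y i k l = 0.
  by rewrite /deform_coef !mul0r mulr0 rmorph0 !mul0r !addr0.
by congr (_ + _); rewrite !big1 // => ? _; rewrite big1 // => ? _;
  rewrite big1 // => ? _; rewrite coef0 mul0r.
Qed.

(** Pairs encode sizes minus one. Both new sizes are successors by definition, so the predecessors
    cancel by computation. *)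
Definition contract_index (p : nat * nat) : nat * nat :=
  ((new_phys p.1.+1 p.2.+1).-1, (new_bond p.2.+1).-1).

Definition contract_level p (A : Ebd_space C p.1.+1 p.2.+1) (u : R) :
    Ebd_space C (contract_index p).1.+1 (contract_index p).2.+1 :=
  exist _ (contract p.1.+1 p.2.+1 (set_val A) u)
    (mem_set (contract_Ebd u (set_valP A))).

(** Each entry is a finite sum of products of continuous functions. The only division is by the
    square root of [sqnorm], which is positive on [Ebd]. *)
Lemma contract_level_continuous p :
  continuous (fun Au : Ebd_space C p.1.+1 p.2.+1 * R => contract_level Au.1 Au.2).
Proof.
pose T := (Ebd_space C p.1.+1 p.2.+1 * R)%type : topologicalType.
have cu : continuous (fun Au : T => Au.2) by move=> x; exact: cvg_snd.
have cA (i : 'I_p.1.+1) (k l : 'I_p.2.+1) :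
    continuous (fun Au : T => entry (set_val Au.1) i k l).
  apply: (cont_comp (@entry_continuous _ _ _ i k l) (f := fun Au : T => Au.1)).
  by move=> x; exact: cvg_fst.
have cclamp (a : R) : continuous (fun Au : T => clamp (Au.2 + a)).
  apply: (cont_comp (@clamp_continuous R)).
  by apply: (@cont_add _ R) => //; exact: cont_cst.
have cangle : continuous (fun Au : T => angle Au.2) by exact: cclamp.
have ccos : continuous (fun Au : T => cosine (angle Au.2)).
  exact: (cont_comp (@cosine_continuous R) cangle).
have cV k x : continuous (fun Au : T => shift_cols Au.2 k x).
  apply: (cont_comp io_cont); apply: (@isocol_continuous _ R).
    apply: (cont_comp (@cosine_continuous R)); exact: (cont_comp (@clamp_continuous R)).
  exact: (cont_comp (@clamp_continuous R)).
have cN : continuous (fun Au : T => sqnorm p.1.+1 p.2.+1 (set_val Au.1)).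
  do 3![apply: (@cont_sum _ R) => ?].
  by apply: (cont_comp nsq_cont); exact: cA.
have crow : continuous (fun Au : T => row_coef Au.2 (sqnorm p.1.+1 p.2.+1 (set_val Au.1))).
  apply: (cont_comp io_cont); apply: (@cont_mul _ R).
    by apply: (@cont_mul _ R) => //; exact: cclamp.
  apply: (@cont_inv _ R) => [[A u] /=|]; last exact: (cont_comp (@sqrt_continuous R)).
  have [chi /= /andP[chi_gt0 _] EA] := set_valP A.
  by rewrite sqrtr_eq0 -ltNge; exact: sqnorm_gt0 chi_gt0 EA.
have ccol : continuous (fun Au : T => col_coef Au.2).
  apply: (cont_comp io_cont); apply: (@cont_mul _ R) => //.
  apply: (cont_comp (@clamp_continuous R)); apply: (@cont_add _ R); first exact: cont_cst.
  by apply: (@cont_opp _ R).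
have cio f : continuous f -> continuous (fun Au : T => io (f Au)) by exact: cont_comp.
apply: Ebd_space_continuous => n x y.
have := @cont_add T C (fun Au => \sum_(i < p.1.+1) \sum_(k < p.2.+1) \sum_(l < p.2.+1)
    deform_coef (shift_cols Au.2) (io (cosine (angle Au.2)))
      (row_coef Au.2 (sqnorm p.1.+1 p.2.+1 (set_val Au.1))) (col_coef Au.2) n x y i k l
    * entry (set_val Au.1) i k l)
  (fun Au => io (angle Au.2) * ((n == 0 :> nat) && (x == 0 :> nat) && (y == 0 :> nat))%N%:R).
apply.
  do 3![apply: cont_sum => ?]; apply: cont_mul => //.
  apply: (@cont_add T C (fun Au => _ * _ + _ * _) (fun Au => _ * _)).
    apply: (@cont_add T C (fun Au => _ * _) (fun Au => _ * _)).
      by apply: cont_mul; [exact: cio|do 2?[apply: cont_mul => //]].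
    apply: cont_mul => //; do 2?[apply: cont_mul => //; first exact: cont_cst].
  apply: cont_mul => //; apply: cont_mul; first exact: cont_cst.
  by apply: cont_mul => //; exact: cont_cst.
by apply: cont_mul; [exact: cio|exact: cont_cst].
Qed.

Lemma Espace_contractible : contractible R (Espace C).
Proof.
(* A level and a preimage are picked for every point without any continuity; [HE] shows that [H]
   does not depend on the choice. *)
have level (s : Emps (C := C)) : {p : nat * nat &
    {A : Ebd_space C p.1.+1 p.2.+1 | @Ebd_to_Emps C p A = s}}.
  by have /cid[p /cid[A As]] := Ebd_to_Emps_surj s; exists p, A.
have emps_inj (s s' : Emps (C := C)) : set_val s = set_val s' -> s = s'.
  exact: val_inj.
pose H (su : Espace C * R) : Espace C :=
  Ebd_to_Emps (contract_level (projT1 (projT2 (level su.1))) su.2).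
have HE p (A : Ebd_space C p.1.+1 p.2.+1) u :
    H (Ebd_to_Emps A, u) = Ebd_to_Emps (contract_level A u).
  rewrite /H; case: (level _) => p' [A' /= A'E].
  have vE : set_val A' = set_val A by have := congr1 set_val A'E.
  apply: emps_inj.
  change (contract p'.1.+1 p'.2.+1 (set_val A') u = contract p.1.+1 p.2.+1 (set_val A) u).
  rewrite vE; apply: contract_indep.
    by rewrite -vE; exact: Ebd_sub_Mbd (set_valP A').
  exact: Ebd_sub_Mbd (set_valP A).
have cH : continuous H.
  apply: final_prod_continuous; first exact: Ebd_to_Emps_surj.
  move=> p; rewrite (_ : (fun _ => _) = fun Au : Ebd_space C p.1.+1 p.2.+1 * R =>
    Ebd_to_Emps (contract_level Au.1 Au.2) : Espace C); last first.
    by apply/funext => Au; rewrite HE.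
  apply: (cont_comp (@Ebd_to_Emps_continuous C _)).
  exact: contract_level_continuous.
pose Z : Marr C := @array C 0 0 (fun _ _ _ => 0) (fun _ _ _ _ => erefl).
have E0 : Ebd (new_phys 1 1) (new_bond 1) (contract 1 1 Z 4).
  by exists 1%N => //; apply: contract_vector; apply: clamp_ge1; lra.
pose x0 : Ebd_space C (contract_index (0, 0)%N).1.+1 (contract_index (0, 0)%N).2.+1 :=
  exist _ (contract 1 1 Z 4) (mem_set E0).
(* The factor [4] stretches the unit interval over the four stages. *)
exists (Ebd_to_Emps x0), (fun st => H (st.1, 4 * set_val st.2)); split.
- pose T := (Espace C * set_type (`[0, 1] : set R))%type : topologicalType.
  have c2 : continuous (fun st : T => set_val st.2 : R).
    apply: (cont_comp (@initial_continuous _ R set_val) (f := fun st : T => st.2)).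
    by move=> x; exact: cvg_snd.
  have c4 : continuous (fun st : T => 4 * set_val st.2 : R).
    by apply: (@cont_mul T R) => //; exact: cont_cst.
  apply: (cont_comp cH (f := fun st : T => (st.1, 4 * set_val st.2))) => st.
  move=> U [[P Q] /= [nP nQ] PQ];
  have hP : \forall x \near st, P x.1 by apply: (cvg_fst nP).
  have hQ : \forall x \near st, Q (4 * set_val x.2) by exact: (c4 st _ nQ).
  by apply: filterS2 hP hQ => x Px Qx; exact: (PQ (x.1, _)).
- move=> s t /= ->; rewrite mulr0; have [p [A <-]] := Ebd_to_Emps_surj s.
  rewrite HE; apply: emps_inj; apply: contract0.
  exact: Ebd_sub_Mbd (set_valP A).
- move=> s t /= ->; rewrite mulr1; have [p [A <-]] := Ebd_to_Emps_surj s.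
  by rewrite HE; apply: emps_inj; exact: contract4.
Qed.

End Contraction.

(** * Continuity for the complex numbers *)

Section Complex.
Variable R : realType.
Let C : numClosedFieldType := R[i].

Lemma real_complex_continuous : continuous (real_complex R : R -> C).
Proof.
move=> x U /nbhs_ballP[e /= e0 eU].
(* Radii of balls in [C] are positive elements of [C], hence real. *)
have eE : (complex.Re e)%:C%C = e by apply: RRe_real; exact: gtr0_real.
apply/nbhs_ballP; exists (complex.Re e) => /=; first by rewrite -ltcR eE.
move=> y xy; apply: eU; rewrite /ball /= -rmorphB normc_def /=.
by rewrite expr0n addr0 sqrtr_sqr -eE ltcR.
Qed.

(** The two assumptions make [f] 1-Lipschitz. *)
Lemma dominated_by_norm_continuous (f : C -> R) :
  (forall z w, f (z - w) = f z - f w) -> (forall z : C, (`|f z|%:C)%C <= `|z|) ->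
  continuous f.
Proof.
move=> fB fle z U /nbhs_ballP[e /= e0 eU].
apply/nbhs_ballP; exists (e%:C)%C => /=; first by rewrite ltcR.
move=> w zw; apply: eU; rewrite /ball /= -fB.
by rewrite -ltcR; apply: le_lt_trans (fle _) zw.
Qed.

Lemma Re_continuous : continuous (@complex.Re R : C -> R).
Proof.
by apply: dominated_by_norm_continuous => [[? ?] [? ?]|z] //; exact: normc_ge_Re.
Qed.

Lemma Im_continuous : continuous (@complex.Im R : C -> R).
Proof.
apply: dominated_by_norm_continuous => [[? ?] [? ?]|z] //.
by rewrite normc_def lecR -sqrtr_sqr ler_wsqrtr // lerDr sqr_ge0.
Qed.

End Complex.

Theorem theorem3p6 (R : realType) : contractible R (Espace R[i]).
Proof.
apply: (@Espace_contractible R _ (real_complex R)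
  (fun z => complex.Re z ^+ 2 + complex.Im z ^+ 2)).
- exact: real_complex_continuous.
- by apply: (@cont_add _ R); apply: (@cont_mul _ R);
    solve [exact: Re_continuous | exact: Im_continuous].
- by move=> x; apply: conj_Creal; apply/complex_realP; exists x.
- by move=> z; rewrite -normCK; exact: add_Re2_Im2.
- by move=> z; rewrite addr_ge0 ?sqr_ge0.
Qed.
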